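(* For every positive integer $n$, $\Psi(Q_n)=M(n)+1$.
   Context: $Q_n$ is the $n$-dimensional hypercube: vertex set $\{0,1\}^n$, two vertices adjacent iff they differ in exactly one coordinate. A set $S$ of vertices of a graph $G$ is doubly resolving if for all distinct vertices $u,v$ there are $x,y\in S$ with $d_G(u,x)-d_G(u,y)\neq d_G(v,x)-d_G(v,y)$; $\Psi(G)$ is the minimum cardinality of a doubly resolving set. A set $S\subseteq\{0,1\}^n$ is a weighing strategy if for every pair of distinct $u,v\in\{0,1\}^n$ there exists $x\in S$ with $u\cdot x\neq v\cdot x$, where $u\cdot x=\sum_{i=1}^n u_ix_i$ (integer sum). $M(n)$ is the minimum cardinality of a weighing strategy (the coin weighing number). *)

(* Defs.v *)
From mathcomp Require Import all_boot all_order all_algebra.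

Set Implicit Arguments.
Unset Strict Implicit.
Unset Printing Implicit Defensive.

Import GRing.Theory.

Section Graph.

Variables (T : finType) (e : rel T).

Definition walk (k : nat) (u v : T) : bool :=
  [exists p : k.-tuple T, path e u p && (last u p == v)].

(* Length of a shortest walk from u to v. A shortest walk has fewer than #|T|
   edges, so the search range is exhaustive when v is reachable from u; the
   value is #|T| otherwise. *)
Definition gdist (u v : T) : nat :=
  find (fun k => walk k u v) (iota 0 #|T|).

Definition doubly_resolving (S : {set T}) : bool :=
  [forall u : T, forall v : T, (u != v) ==>
    [exists x in S, exists y in S,
      ((gdist u x)%:Z - (gdist u y)%:Z != (gdist v x)%:Z - (gdist v y)%:Z)%R]].

(* [arg min] defaults to the full vertex set when no S is doubly resolving;
   see doubly_resolvingT for connected graphs. *)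
Definition Psi : nat :=
  #|[arg min_(S < [set: T] | doubly_resolving S) #|S| ]|.

Lemma gdistP (u v : T) : connect e u v ->
  walk (gdist u v) u v /\ (forall k, walk k u v -> gdist u v <= k).
Proof.
move=> /connectP [p0 ep0 defw].
have [p [ep lw Up]] : exists p, [/\ path e u p, last u p = v & uniq (u :: p)].
  by rewrite defw; case/shortenP: ep0 => p ep Up _; exists p.
have szp : size p < #|T| by have := max_card [in u :: p]; rewrite (card_uniqP Up).
have wp : walk (size p) u v.
  by apply/existsP; exists (in_tuple p); rewrite /= ep lw eqxx.
have hasw : has (fun k => walk k u v) (iota 0 #|T|).
  by apply/hasP; exists (size p); rewrite ?mem_iota.
split.
  have := nth_find 0 hasw.
  by rewrite nth_iota ?add0n // -[X in _ < X](size_iota 0) -has_find.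
move=> k wk; rewrite leqNgt; apply/negP => lt_k.
have := before_find 0 lt_k; rewrite nth_iota ?add0n ?wk //.
by apply: leq_trans lt_k _; rewrite -[X in _ <= X](size_iota 0) find_size.
Qed.

Lemma gdist_refl (u : T) : gdist u u = 0.
Proof.
apply/eqP; rewrite -leqn0; apply: (proj2 (gdistP (connect0 e u))).
by apply/existsP; exists [tuple]; rewrite /= eqxx.
Qed.

Lemma gdist_eq0 (u v : T) : connect e u v -> gdist u v = 0 -> u = v.
Proof.
move=> /gdistP [+ _] d0; rewrite d0 => /existsP [p].
by rewrite tuple0 /= => /eqP.
Qed.

Lemma doubly_resolvingT :
  (forall u v, connect e u v) -> doubly_resolving [set: T].
Proof.
move=> conn; apply/forallP => u; apply/forallP => v; apply/implyP => neq_uv.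
apply/existsP; exists u; rewrite inE; apply/existsP; exists v; rewrite inE /=.
rewrite !gdist_refl sub0r subr0; apply: contra neq_uv => /eqP E.
apply/eqP/gdist_eq0 => //.
by move: E; case: (gdist u v) (gdist v u) => [|m] [|k].
Qed.

End Graph.

Section Hypercube.

Variable n : nat.

Definition cube : finType := {ffun 'I_n -> bool}.

Definition hypercube : rel cube := fun u v => #|[set i | u i != v i]| == 1.

Definition dot (u x : cube) : nat := \sum_(i < n) u i * x i.

Definition weighing_strategy (S : {set cube}) : bool :=
  [forall u : cube, forall v : cube, (u != v) ==>
    [exists x in S, dot u x != dot v x]].

Definition coin_weighing_number : nat :=
  #|[arg min_(S < [set: cube] | weighing_strategy S) #|S| ]|.

Lemma weighing_strategyT : weighing_strategy [set: cube].
Proof.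
apply/forallP => u; apply/forallP => v; apply/implyP => neq_uv.
have dotE (w : cube) i : dot w [ffun j => j == i] = w i.
  rewrite /dot (bigD1 i) //= ffunE eqxx muln1 big1 ?addn0 // => j /negbTE ji.
  by rewrite ffunE ji muln0.
apply/existsP; case: (pickP (fun i => u i != v i)) => [i neq_i | eq_uv].
  exists [ffun j => j == i]; rewrite inE !dotE.
  by case: (u i) (v i) neq_i => [] [].
case/eqP: neq_uv; apply/ffunP => i; apply/eqP.
exact: (negbFE (eq_uv i)).
Qed.

Lemma hypercube_connected (u v : cube) : connect hypercube u v.
Proof.
have [m] := ubnP #|[set i | u i != v i]|; elim: m u => // m IH u lt_m.
case: (pickP (fun i => u i != v i)) => [i neq_i | eq_uv]; last first.
  suff -> : u = v by apply: connect0.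
  by apply/ffunP => i; apply/eqP; apply: (negbFE (eq_uv i)).
pose w : cube := [ffun j => if j == i then v j else u j].
apply: (@connect_trans _ _ w); last apply: IH.
  apply: connect1; apply/cards1P; exists i; apply/setP => j; rewrite !inE ffunE.
  by case: (eqVneq j i) => [-> // | _]; rewrite eqxx.
apply: leq_trans (_ : #|[set i | u i != v i]| <= m); last by rewrite -ltnS.
apply: proper_card; apply/properP; split.
  by apply/subsetP => j; rewrite !inE ffunE; case: (eqVneq j i) => // ->; rewrite eqxx.
by exists i; rewrite !inE // ffunE eqxx eqxx.
Qed.

End Hypercube.

Arguments hypercube n : clear implicits.

(* Main.v *)
(** Distance in the hypercube is Hamming distance, which is invariant under
    translation by any vertex (coordinatewise xor) and satisfies
    [d(u, x) = |u| + |x| - 2 (u . x)]. When [0 \in S], double resolvability may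
    be tested with [y = 0] only, and [d(u, x) - d(u, 0) = |x| - 2 (u . x)]; hence
    [S] is doubly resolving iff [S] minus [0] is a weighing strategy. A
    nonempty doubly resolving set can be translated so that it contains [0]. *)
Require Import Defs.
From mathcomp Require Import all_boot all_order all_algebra.
From mathcomp Require Import zify.

Set Implicit Arguments.
Unset Strict Implicit.
Unset Printing Implicit Defensive.

Lemma walkS (T : finType) (e : rel T) k (u v : T) :
  walk e k.+1 u v = [exists w, e u w && walk e k w v].
Proof.
apply/existsP/existsP => [[p] | [w /andP[euw /existsP[p /andP[ep lp]]]]].
  case/tupleP: p => w p /= /andP[/andP[euw ep] lp].
  by exists w; rewrite euw; apply/existsP; exists p; rewrite ep.
by exists [tuple of w :: p]; rewrite /= euw ep.
Qed.

Section HammingDistance.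

Variable n : nat.
Implicit Types u v w x a : cube n.

Definition hamming u v : nat := \sum_(i < n) (u i != v i).

Definition weight u : nat := \sum_(i < n) u i.

Definition cube0 : cube n := [ffun=> false].

Definition cube_xor u a : cube n := [ffun i => u i (+) a i].

Lemma hamming_card u v : hamming u v = #|[set i | u i != v i]|.
Proof.
rewrite -sum1_card big_mkcond /=; apply: eq_bigr => i _.
by rewrite inE; case: (_ != _).
Qed.

Lemma hypercubeE u v : hypercube n u v = (hamming u v == 1).
Proof. by rewrite hamming_card. Qed.

Lemma hamming_eq0 u v : hamming u v = 0 -> u = v.
Proof.
move/eqP; rewrite sum_nat_eq0 => /forallP h; apply/ffunP => i.
by move: (h i) => /=; case: (u i) (v i) => [] [].
Qed.

Lemma hamming_triangle u v w : hamming u w <= hamming u v + hamming v w.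
Proof.
rewrite -big_split /=; apply: leq_sum => i _.
by case: (u i) (v i) (w i) => [] [] [].
Qed.

(** Translation by [a] is an isometry and its own inverse, so it may be shifted from one argument to
    the other. *)
Lemma hamming_xor u a x : hamming (cube_xor u a) x = hamming u (cube_xor x a).
Proof.
by apply: eq_bigr => i _; rewrite !ffunE; case: (u i) (a i) (x i) => [] [] [].
Qed.

(** Coordinatewise this is the bit identity [(b != c) + 2 * (b * c) = b + c]; the additive form
    avoids truncated subtraction. *)
Lemma hamming_dot u x : hamming u x + 2 * dot u x = weight u + weight x.
Proof.
rewrite /dot big_distrr -!big_split /=; apply: eq_bigr => i _.
by case: (u i) (x i) => [] [].
Qed.

Lemma cube_xorK a : involutive (cube_xor^~ a).
Proof. by move=> u; apply/ffunP => i; rewrite !ffunE addbK. Qed.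

Lemma cube_xorxx a : cube_xor a a = cube0.
Proof. by apply/ffunP => i; rewrite !ffunE addbb. Qed.

Lemma dot0 u : dot u cube0 = 0.
Proof. by rewrite /dot big1 // => i _; rewrite ffunE muln0. Qed.

Lemma hypercube_walk_hamming k u v : walk (hypercube n) k u v -> hamming u v <= k.
Proof.
elim: k u => [|k IH] u.
  case/existsP=> p; rewrite tuple0 /= => /eqP->.
  by rewrite /hamming big1 // => i _; rewrite eqxx.
rewrite walkS => /existsP[w /andP[]]; rewrite hypercubeE => /eqP uw /IH wv.
by apply: leq_trans (hamming_triangle u w v) _; rewrite uw.
Qed.

(** A walk of this length corrects the differing coordinates one at a time. *)
Lemma hypercube_walk u v : walk (hypercube n) (hamming u v) u v.
Proof.
move Dk: (hamming u v) => k; elim: k u Dk => [|k IH] u Dk.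
  by rewrite (hamming_eq0 Dk); apply/existsP; exists [tuple]; rewrite /= eqxx.
have /card_gt0P[i Di] : 0 < #|[set i | u i != v i]| by rewrite -hamming_card Dk.
have neq_i : u i != v i by rewrite inE in Di.
pose w : cube n := [ffun j => if j == i then v j else u j].
rewrite walkS; apply/existsP; exists w; apply/andP; split.
  apply/cards1P; exists i; apply/setP => j; rewrite !inE ffunE.
  by case: (eqVneq j i) => [-> // | _]; rewrite eqxx.
(* The coordinates where [w] and [v] differ are those where [u] and [v] differ, with [i] removed. *)
apply: IH; move: Dk; rewrite !hamming_card (cardsD1 i) Di => -[<-].
apply: eq_card => j; rewrite !inE ffunE.
by case: (eqVneq j i) => //= ->; rewrite eqxx.
Qed.

Lemma gdist_hypercube u v : gdist (hypercube n) u v = hamming u v.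
Proof.
have [wd min_d] := gdistP (hypercube_connected u v).
by apply/eqP; rewrite eqn_leq min_d ?hypercube_walk // hypercube_walk_hamming.
Qed.

Lemma weighing_strategyP (S : {set cube n}) :
  reflect (forall u v, (forall x, x \in S -> dot u x = dot v x) -> u = v)
          (weighing_strategy S).
Proof.
apply: (iffP forallP) => [wS u v eq_uv | wS u].
  apply/eqP; apply: contraT => neq_uv.
  have /existsP[x /andP[xS]] := implyP (forallP (wS u) v) neq_uv.
  by rewrite eq_uv ?eqxx.
apply/forallP => v; apply/implyP; apply: contraNT => /existsPn h.
apply/eqP/wS => x xS; apply/eqP.
by move: (h x); rewrite xS negbK.
Qed.

(** Contrapositive form, with the integer differences rearranged into sums of natural numbers. *)
Lemma doubly_resolving_hypercubeP (S : {set cube n}) :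
  reflect (forall u v, (forall x y, x \in S -> y \in S ->
             hamming u x + hamming v y = hamming v x + hamming u y) -> u = v)
          (doubly_resolving (hypercube n) S).
Proof.
apply: (iffP forallP) => [dS u v eq_uv | dS u].
  apply/eqP; apply: contraT => neq_uv.
  have /existsP[x /andP[xS]] := implyP (forallP (dS u) v) neq_uv.
  case/existsP=> y /andP[yS]; rewrite !gdist_hypercube.
  by have := eq_uv x y xS yS; lia.
apply/forallP => v; apply/implyP; apply: contraNT => /existsPn h.
apply/eqP/dS => x y xS yS.
move: (h x); rewrite xS => /existsPn/(_ y); rewrite yS !gdist_hypercube negbK.
by move/eqP; lia.
Qed.

Lemma doubly_resolving_of_weighing (W : {set cube n}) :
  weighing_strategy W -> doubly_resolving (hypercube n) (cube0 |: W).
Proof.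
move/weighing_strategyP=> wW; apply/doubly_resolving_hypercubeP => u v eq_uv.
apply: wW => x xW.
(* Taking [y = cube0] makes the weights of [u], [v] and [x] cancel, leaving [dot u x = dot v x]. *)
have := eq_uv x cube0 (setU1r _ xW) (setU11 _ _).
have := hamming_dot u x; have := hamming_dot v x.
have := hamming_dot u cube0; have := hamming_dot v cube0.
by rewrite !dot0; lia.
Qed.

(** Translating by [a] sends [a] itself to [cube0], which has dot product 0 with every vertex and so
    separates no pair; dropping it saves one element. *)
Lemma weighing_of_doubly_resolving (S : {set cube n}) a :
  doubly_resolving (hypercube n) S ->
  weighing_strategy [set cube_xor x a | x in S :\ a].
Proof.
move/doubly_resolving_hypercubeP=> dS; apply/weighing_strategyP => u v eq_uv.
have eq_dot x : x \in S -> dot u (cube_xor x a) = dot v (cube_xor x a).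
  have [-> _ | neq_xa xS] := eqVneq x a; first by rewrite cube_xorxx !dot0.
  by apply: eq_uv; apply: imset_f; rewrite !inE neq_xa.
(* Resolvability is applied to the translates of [u] and [v]; [hamming_xor] then moves the
   translation onto [x] and [y]. *)
apply: (inv_inj (cube_xorK a)); apply: dS => x y xS yS; rewrite !hamming_xor.
have := hamming_dot u (cube_xor x a); have := hamming_dot v (cube_xor x a).
have := hamming_dot u (cube_xor y a); have := hamming_dot v (cube_xor y a).
by rewrite !eq_dot //; lia.
Qed.

(** An empty set would identify all vertices, but for positive [n] the all-false and all-true
    vertices differ. *)
Lemma doubly_resolving_neq0 (S : {set cube n}) :
  0 < n -> doubly_resolving (hypercube n) S -> S != set0.
Proof.
move=> n_gt0 /doubly_resolving_hypercubeP dS; apply/eqP => S0.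
have /ffunP/(_ (Ordinal n_gt0)) : cube0 = [ffun=> true].
  by apply: dS => x y; rewrite S0 inE.
by rewrite !ffunE.
Qed.

End HammingDistance.

Theorem theorem8 (n : nat) (n_gt0 : 0 < n) :
  Psi (hypercube n) = coin_weighing_number n + 1.
Proof.
rewrite /Psi /coin_weighing_number.
case: arg_minnP => [|S dS minS].
  exact/doubly_resolvingT/hypercube_connected.
case: arg_minnP => [|W wW minW]; first exact: weighing_strategyT.
apply/eqP; rewrite eqn_leq; apply/andP; split.
  apply: leq_trans (minS _ (doubly_resolving_of_weighing wW)) _.
  (* Adjoining [cube0] adds the boolean [cube0 \notin W] to the cardinality, hence at most 1. *)
  by rewrite cardsU1 addnC leq_add2l leq_b1.
have /set0Pn[a aS] := doubly_resolving_neq0 n_gt0 dS.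
(* The removed element [a] accounts for the [+ 1]. *)
rewrite (cardsD1 a S) aS addnC leq_add2l.
apply: leq_trans (minW _ (weighing_of_doubly_resolving a dS)) _.
exact: leq_imset_card.
Qed.
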